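(* Let $G$ be a simply-connected compact simple Lie group with Lie algebra $\mathfrak{g}$, and let $k\in\mathbb{Z}$. There is a strictly exact sequence of Lie 2-algebra homomorphisms $$0\to\mathcal{E}\Omega\mathfrak{g}\xrightarrow{\ \lambda\ }\mathcal{P}_k\mathfrak{g}\xrightarrow{\ \phi\ }\mathfrak{g}_k\to0$$ where $\mathcal{E}\Omega\mathfrak{g}$ is equivalent to the trivial Lie 2-algebra and $\phi$ is an equivalence of Lie 2-algebras.
   Context: **Lie 2-algebras.** Lie 2-algebras are described through the known equivalent notion of 2-term $L_\infty$-algebras. A 2-term $L_\infty$-algebra $V$ consists of real vector spaces $V_0,V_1$, a linear map $d\colon V_1\to V_0$, bilinear maps $l_2\colon V_i\times V_j\to V_{i+j}$ for $0\le i+j\le 1$, and a trilinear map $l_3\colon V_0\times V_0\times V_0\to V_1$, such that, writing $[\cdot,\cdot]=l_2$, for all $w,x,y,z\in V_0$, $h,h'\in V_1$: $[x,y]=-[y,x]$; $[x,h]=-[h,x]$; $l_3$ is totally antisymmetric; $d[x,h]=[x,dh]$; $[dh,h']=[h,dh']$; $d\,l_3(x,y,z)=[x,[y,z]]+[[x,z],y]-[[x,y],z]$; $l_3(x,y,dh)=[x,[y,h]]+[[x,h],y]-[[x,y],h]$; and $[l_3(w,x,y),z]+l_3([w,y],x,z)+l_3(w,[x,y],z)+[l_3(w,y,z),x]+[w,l_3(x,y,z)]=l_3([w,x],y,z)+[l_3(w,x,z),y]+l_3(w,[x,z],y)+l_3([w,z],x,y)+l_3(w,x,[y,z])$. The corresponding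 Lie 2-algebra has space of objects $V_0$, space of morphisms $V_0\oplus V_1$, $s(x,h)=x$, $t(x,h)=x+dh$. The trivial Lie 2-algebra has $V_0=V_1=0$. **Homomorphisms.** A homomorphism $\phi\colon V\to V'$ consists of a chain map $(\phi_0,\phi_1)$ and a skew-symmetric bilinear map $\phi_2\colon V_0\times V_0\to V_1'$ such that for all $x,y,z\in V_0$, $h\in V_1$: (i) $d\phi_2(x,y)=\phi_0(l_2(x,y))-l_2(\phi_0(x),\phi_0(y))$; (ii) $\phi_2(x,dh)=\phi_1(l_2(x,h))-l_2(\phi_0(x),\phi_1(h))$; (iii) $\phi_1(l_3(x,y,z))-l_3(\phi_0(x),\phi_0(y),\phi_0(z))=\phi_2(x,l_2(y,z))+\phi_2(y,l_2(z,x))+\phi_2(z,l_2(x,y))+l_2(\phi_0(x),\phi_2(y,z))+l_2(\phi_0(y),\phi_2(z,x))+l_2(\phi_0(z),\phi_2(x,y))$. Composition: compose chain maps, and $(\psi\circ\phi)_2(x,y)=\psi_2(\phi_0(x),\phi_0(y))+\psi_1(\phi_2(x,y))$. The identity has $\mathrm{id}_2=0$. On morphisms of Lie 2-algebras, $\phi$ acts as $\phi_0\oplus\phi_1$. A 2-homomorphism $\tau\colon\phi\Rightarrow\psi$ is a linear map $\tau\colon V_0\to V_1'$ with $d\tau=\psi_0-\phi_0$, $\tau d=\psi_1-\phi_1$ and $\phi_2(x,y)-\psi_2(x,y)=l_2(\phi_0(x),\tau(y))+l_2(\tau(x),\psi_0(y))-\tau(l_2(x,y))$; every 2-homomorphism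 is invertible. A homomorphism $\phi$ is an equivalence if there is a homomorphism $\psi$ in the other direction with $\phi\circ\psi$ and $\psi\circ\phi$ each isomorphic, via a 2-homomorphism, to the identity; two Lie 2-algebras are equivalent if there is an equivalence between them. **Strictly exact** means that, both on the vector spaces of objects and on the vector spaces of morphisms, the image of each map is the kernel of the next. **Notation.** $\langle\cdot,\cdot\rangle$ is the basic inner product on $\mathfrak{g}$ divided by $4\pi$ (the basic inner product is the unique invariant one with $(h_\theta,h_\theta)=2$ for $h_\theta$ the coroot of the highest root). $P_0\mathfrak{g}=\{f\in C^\infty([0,2\pi],\mathfrak{g}):f(0)=0\}$ and $\Omega\mathfrak{g}=\{f\in P_0\mathfrak{g}:f(2\pi)=0\}$, with pointwise brackets. **$\mathfrak{g}_k$:** $V_0=\mathfrak{g}$, $V_1=\mathbb{R}$, $d=0$, $l_2$ on $V_0\times V_0$ the bracket of $\mathfrak{g}$, $l_2=0$ on $V_0\times V_1$, $l_3(x,y,z)=k\langle x,[y,z]\rangle$. **$\mathcal{P}_k\mathfrak{g}$** (the Lie 2-algebra of the Fréchet Lie 2-group $\mathcal{P}_kG$ whose objects are the based paths $P_0G$ and whose morphisms are $P_0G\ltimes\widehat{\Omega_kG}$, with $\widehat{\Omega_kG}$ the level-$k$ Kac–Moody central extension of $\Omega G$); explicitly: $V_0=P_0\mathfrak{g}$, $V_1=\Omega\mathfrak{g}\oplus\mathbb{R}$, $d(\ell,c)=\ell$, $l_2(p_1,p_2)=[p_1,p_2]$, $l_2(p,(\ell,c))=-l_2((\ell,c),p)=\big([p,\ell],\,2k\int_0^{2\pi}\langle\ell(\theta),p'(\theta)\rangle\,d\theta\big)$,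 $l_3=0$. **$\mathcal{E}L$** for a Lie algebra $L$: $V_0=V_1=L$, $d=\mathrm{id}$, $l_2$ on $V_0\times V_0$ and $V_0\times V_1$ given by the bracket of $L$, $l_3=0$. *)

(* Defs.v *)
From HB Require Import structures.
From mathcomp Require Import all_boot all_order all_algebra.
From mathcomp Require Import all_classical all_reals all_analysis.
From mathcomp Require Import ring lra.

Set Implicit Arguments.
Unset Strict Implicit.
Unset Printing Implicit Defensive.

Import Order.TTheory GRing.Theory Num.Theory.
Import numFieldNormedType.Exports.

Local Open Scope classical_set_scope.
Local Open Scope ring_scope.

Section multilinear.
Variable R : realType.

Definition bilin (U V W : lmodType R) (f : U -> V -> W) : Prop :=
  (forall y, linear (f^~ y)) /\ (forall x, linear (f x)).

Definition trilin (U V W X : lmodType R) (f : U -> V -> W -> X) : Prop :=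
  [/\ forall y z, linear (fun x => f x y z),
      forall x z, linear (fun y => f x y z)
    & forall x y, linear (f x y)].

Section bilin_lemmas.
Variables (U V W : lmodType R) (f : U -> V -> W).
Hypothesis fb : bilin f.

Lemma bilinDl x x' y : f (x + x') y = f x y + f x' y.
Proof. by have := fb.1 y 1 x x'; rewrite !scale1r. Qed.

Lemma bilinDr x y y' : f x (y + y') = f x y + f x y'.
Proof. by have := fb.2 x 1 y y'; rewrite !scale1r. Qed.

Lemma bilin0l y : f 0 y = 0.
Proof. by apply: (addrI (f 0 y)); rewrite -bilinDl !addr0. Qed.

Lemma bilin0r x : f x 0 = 0.
Proof. by apply: (addrI (f x 0)); rewrite -bilinDr !addr0. Qed.

Lemma bilinZl a x y : f (a *: x) y = a *: f x y.
Proof. by have := fb.1 y a x 0; rewrite bilin0l !addr0. Qed.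

Lemma bilinZr a x y : f x (a *: y) = a *: f x y.
Proof. by have := fb.2 x a y 0; rewrite bilin0r !addr0. Qed.

Lemma bilinNl x y : f (- x) y = - f x y.
Proof. by rewrite -scaleN1r bilinZl scaleN1r. Qed.

Lemma bilinNr x y : f x (- y) = - f x y.
Proof. by rewrite -scaleN1r bilinZr scaleN1r. Qed.

Lemma bilin_suml (I : Type) (s : seq I) (F : I -> U) y :
  f (\sum_(i <- s) F i) y = \sum_(i <- s) f (F i) y.
Proof.
elim: s => [|i s ih]; first by rewrite !big_nil bilin0l.
by rewrite !big_cons bilinDl ih.
Qed.

Lemma bilin_sumr (I : Type) (s : seq I) x (F : I -> V) :
  f x (\sum_(i <- s) F i) = \sum_(i <- s) f x (F i).
Proof.
elim: s => [|i s ih]; first by rewrite !big_nil bilin0r.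
by rewrite !big_cons bilinDr ih.
Qed.

End bilin_lemmas.
End multilinear.

Record lieBracket (R : realType) (L : lmodType R) := LieBracket {
  lie_op :> L -> L -> L;
  lie_bilin : bilin lie_op;
  lie_alt : forall x, lie_op x x = 0;
  lie_jacobi : forall x y z,
    lie_op x (lie_op y z) + lie_op y (lie_op z x) + lie_op z (lie_op x y) = 0
}.

Lemma lie_anti (R : realType) (L : lmodType R) (br : lieBracket L) x y :
  br x y = - br y x.
Proof.
apply/eqP; rewrite -addr_eq0; apply/eqP.
have := lie_alt br (x + y); rewrite (bilinDl (lie_bilin br)).
by rewrite !(bilinDr (lie_bilin br)) !lie_alt add0r addr0.
Qed.

Lemma lie_jacobi3 (R : realType) (L : lmodType R) (br : lieBracket L) x y z :
  br x (br y z) + br (br x z) y - br (br x y) z = 0.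
Proof.
rewrite -(lie_jacobi br x y z) (lie_anti br (br x z)) (lie_anti br (br x y) z).
by rewrite opprK (lie_anti br x z) (bilinNr (lie_bilin br)) opprK.
Qed.

(* Lie 2-algebras, presented as 2-term L-infinity algebras: [dif] is d, the
   components of l_2 on V_0 x V_0, V_0 x V_1 and V_1 x V_0 are [br00], [br01]
   and [br10], and [jac] is l_3. *)
Record lie2Alg (R : realType) := Lie2Alg {
  deg0 : lmodType R;
  deg1 : lmodType R;
  dif : {linear deg1 -> deg0};
  br00 : deg0 -> deg0 -> deg0;
  br01 : deg0 -> deg1 -> deg1;
  br10 : deg1 -> deg0 -> deg1;
  jac : deg0 -> deg0 -> deg0 -> deg1;
  br00_bilin : bilin br00;
  br01_bilin : bilin br01;
  br10_bilin : bilin br10;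
  jac_trilin : trilin jac;
  br00_anti : forall x y, br00 x y = - br00 y x;
  br01_anti : forall x h, br01 x h = - br10 h x;
  jac_anti12 : forall x y z, jac x y z = - jac y x z;
  jac_anti23 : forall x y z, jac x y z = - jac x z y;
  dif_br01 : forall x h, dif (br01 x h) = br00 x (dif h);
  dif_peiffer : forall h h', br01 (dif h) h' = br10 h (dif h');
  dif_jac : forall x y z,
    dif (jac x y z) =
    br00 x (br00 y z) + br00 (br00 x z) y - br00 (br00 x y) z;
  jac_dif : forall x y h,
    jac x y (dif h) =
    br01 x (br01 y h) + br10 (br01 x h) y - br01 (br00 x y) h;
  jac_coherence : forall w x y z,
    br10 (jac w x y) z + jac (br00 w y) x z + jac w (br00 x y) z
      + br10 (jac w y z) x + br01 w (jac x y z) =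
    jac (br00 w x) y z + br10 (jac w x z) y + jac w (br00 x z) y
      + jac (br00 w z) x y + jac w x (br00 y z)
}.

Record lie2Hom (R : realType) (V W : lie2Alg R) := Lie2Hom {
  hom0 : {linear deg0 V -> deg0 W};
  hom1 : {linear deg1 V -> deg1 W};
  hom2 : deg0 V -> deg0 V -> deg1 W;
  hom_chain : forall h, hom0 (dif V h) = dif W (hom1 h);
  hom2_bilin : bilin hom2;
  hom2_anti : forall x y, hom2 x y = - hom2 y x;
  hom2_br00 : forall x y,
    dif W (hom2 x y) = hom0 (br00 x y) - br00 (hom0 x) (hom0 y);
  hom2_br01 : forall x h,
    hom2 x (dif V h) = hom1 (br01 x h) - br01 (hom0 x) (hom1 h);
  hom2_jac : forall x y z,
    hom1 (jac x y z) - jac (hom0 x) (hom0 y) (hom0 z) =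
    hom2 x (br00 y z) + hom2 y (br00 z x) + hom2 z (br00 x y)
      + br01 (hom0 x) (hom2 y z) + br01 (hom0 y) (hom2 z x)
      + br01 (hom0 z) (hom2 x y)
}.

Section lie2_category.
Variable R : realType.
Implicit Types U V W : lie2Alg R.

Section identity.
Variable V : lie2Alg R.

Let id2 (x y : deg0 V) : deg1 V := 0.

Fact id2_bilin : bilin id2.
Proof. by split=> u a x x'; rewrite /id2 scaler0 addr0. Qed.

Fact id2_anti x y : id2 x y = - id2 y x.
Proof. by rewrite /id2 oppr0. Qed.

Fact id2_br00 (x y : deg0 V) :
  dif V (id2 x y) = br00 x y - br00 x y.
Proof. by rewrite linear0 subrr. Qed.

Fact id2_br01 (x : deg0 V) (h : deg1 V) :
  id2 x (dif V h) = br01 x h - br01 x h.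
Proof. by rewrite subrr. Qed.

Fact id2_jac (x y z : deg0 V) :
  jac x y z - jac x y z =
  id2 x (br00 y z) + id2 y (br00 z x) + id2 z (br00 x y)
    + br01 x (id2 y z) + br01 y (id2 z x) + br01 z (id2 x y).
Proof. by rewrite /id2 !(bilin0r (br01_bilin V)) !addr0 subrr. Qed.

Definition idL2 : lie2Hom V V :=
  @Lie2Hom R V V idfun idfun id2 (fun=> erefl)
    id2_bilin id2_anti id2_br00 id2_br01 id2_jac.
End identity.

Section zero.
Variables V W : lie2Alg R.

Let zero2 (x y : deg0 V) : deg1 W := 0.
Let z0 : {linear deg0 V -> deg0 W} := \0.
Let z1 : {linear deg1 V -> deg1 W} := \0.

Fact zero2_bilin : bilin zero2.
Proof. by split=> u a x x'; rewrite /zero2 scaler0 addr0. Qed.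

Fact zero2_anti x y : zero2 x y = - zero2 y x.
Proof. by rewrite /zero2 oppr0. Qed.

Fact zero_chain h : z0 (dif V h) = dif W (z1 h).
Proof. by rewrite /= linear0. Qed.

Fact zero2_br00 x y :
  dif W (zero2 x y) = z0 (br00 x y) - br00 (z0 x) (z0 y).
Proof. by rewrite /= linear0 (bilin0r (br00_bilin W)) subrr. Qed.

Fact zero2_br01 x h :
  zero2 x (dif V h) = z1 (br01 x h) - br01 (z0 x) (z1 h).
Proof. by rewrite /= (bilin0r (br01_bilin W)) subrr. Qed.

Fact zero2_jac x y z :
  z1 (jac x y z) - jac (z0 x) (z0 y) (z0 z) =
  zero2 x (br00 y z) + zero2 y (br00 z x) + zero2 z (br00 x y)
    + br01 (z0 x) (zero2 y z) + br01 (z0 y) (zero2 z x)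
    + br01 (z0 z) (zero2 x y).
Proof.
have [_ _ /(_ 0 0 1 0 0)] := jac_trilin W.
rewrite scaler0 addr0 scale1r => j0.
have {}j0 : jac 0 0 0 = 0 :> deg1 W by apply: (addrI (jac 0 0 0)); rewrite -j0 addr0.
by rewrite /= /zero2 !(bilin0r (br01_bilin W)) j0 !addr0 subrr.
Qed.

Definition zeroL2 : lie2Hom V W :=
  @Lie2Hom R V W z0 z1 zero2 zero_chain
    zero2_bilin zero2_anti zero2_br00 zero2_br01 zero2_jac.
End zero.

Section composition.
Variables (U V W : lie2Alg R) (psi : lie2Hom V W) (phi : lie2Hom U V).

Let c0 : {linear deg0 U -> deg0 W} := hom0 psi \o hom0 phi.
Let c1 : {linear deg1 U -> deg1 W} := hom1 psi \o hom1 phi.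
Let comp2 (x y : deg0 U) : deg1 W :=
  hom2 psi (hom0 phi x) (hom0 phi y) + hom1 psi (hom2 phi x y).

Fact comp_chain h : c0 (dif U h) = dif W (c1 h).
Proof. by rewrite /= !hom_chain. Qed.

Fact comp2_bilin : bilin comp2.
Proof.
have bp := hom2_bilin psi; have bq := hom2_bilin phi.
split=> u a x x'; rewrite /comp2 linearP.
- by rewrite (bilinDl bp) (bilinZl bp) (bilinDl bq) (bilinZl bq) linearP
             scalerDr addrACA.
- by rewrite (bilinDr bp) (bilinZr bp) (bilinDr bq) (bilinZr bq) linearP
             scalerDr addrACA.
Qed.

Fact comp2_anti x y : comp2 x y = - comp2 y x.
Proof.
by rewrite /comp2 (hom2_anti psi) (hom2_anti phi) linearN opprD.
Qed.

Fact comp2_br00 x y :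
  dif W (comp2 x y) = c0 (br00 x y) - br00 (c0 x) (c0 y).
Proof.
rewrite /comp2 linearD /= hom2_br00 -hom_chain hom2_br00 linearB.
by rewrite addrC addrA subrK.
Qed.

Fact comp2_br01 x h :
  comp2 x (dif U h) = c1 (br01 x h) - br01 (c0 x) (c1 h).
Proof.
rewrite /comp2 /= hom_chain !hom2_br01 linearB.
by rewrite addrC addrA subrK.
Qed.

Fact comp2_jac x y z :
  c1 (jac x y z) - jac (c0 x) (c0 y) (c0 z) =
  comp2 x (br00 y z) + comp2 y (br00 z x) + comp2 z (br00 x y)
    + br01 (c0 x) (comp2 y z) + br01 (c0 y) (comp2 z x)
    + br01 (c0 z) (comp2 x y).
Proof.
have E a b e : comp2 a (br00 b e) + br01 (c0 a) (comp2 b e) =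
    (hom2 psi (hom0 phi a) (br00 (hom0 phi b) (hom0 phi e)) +
     br01 (c0 a) (hom2 psi (hom0 phi b) (hom0 phi e))) +
    (hom1 psi (hom2 phi a (br00 b e)) +
     hom1 psi (br01 (hom0 phi a) (hom2 phi b e))).
  have -> : hom1 psi (br01 (hom0 phi a) (hom2 phi b e)) =
      hom2 psi (hom0 phi a) (dif V (hom2 phi b e)) +
      br01 (c0 a) (hom1 psi (hom2 phi b e)).
    by rewrite hom2_br01 subrK.
    rewrite /comp2 hom2_br00 (bilinDr (br01_bilin W)).
  rewrite (bilinDr (hom2_bilin psi)) (bilinNr (hom2_bilin psi)).
  rewrite [RHS](AC (2*(1*(2*1))) ((1*5)*((4*3)*(2*6)))) /=.
  by rewrite subrr add0r.
rewrite (AC 6 ((1*4)*(2*5)*(3*6))) /= !E.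
have := congr1 (hom1 psi) (hom2_jac phi x y z).
rewrite linearB !linearD /= => J.
have K := hom2_jac psi (hom0 phi x) (hom0 phi y) (hom0 phi z).
rewrite -[LHS](subrKA (hom1 psi (jac (hom0 phi x) (hom0 phi y) (hom0 phi z)))).
rewrite J K [LHS](AC (6*6) ((7*10*(1*4))*(8*11*(2*5))*(9*12*(3*6)))) /=.
by [].
Qed.

Definition compL2 : lie2Hom U W :=
  @Lie2Hom R U W c0 c1 comp2 comp_chain
    comp2_bilin comp2_anti comp2_br00 comp2_br01 comp2_jac.
End composition.
End lie2_category.

Section lie2_notions.
Variable R : realType.
Implicit Types U V W : lie2Alg R.

Definition twoHom V W (phi psi : lie2Hom V W)
    (tau : {linear deg0 V -> deg1 W}) : Prop :=
  [/\ forall x, dif W (tau x) = hom0 psi x - hom0 phi x,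
      forall h, tau (dif V h) = hom1 psi h - hom1 phi h
    & forall x y, hom2 phi x y - hom2 psi x y =
        br01 (hom0 phi x) (tau y) + br10 (tau x) (hom0 psi y)
          - tau (br00 x y)].

Definition iso2Hom V W (phi psi : lie2Hom V W) : Prop :=
  exists tau, twoHom phi psi tau.

Definition lie2_equivalence V W (phi : lie2Hom V W) : Prop :=
  exists psi : lie2Hom W V,
    iso2Hom (compL2 phi psi) (idL2 W) /\ iso2Hom (compL2 psi phi) (idL2 V).

Definition lie2_equivalent V W : Prop :=
  exists phi : lie2Hom V W, lie2_equivalence phi.

(* The vector space of morphisms V_0 (+) V_1, on which a homomorphism acts as
   phi_0 (+) phi_1. *)
Definition morphisms V : lmodType R := (deg0 V * deg1 V)%type.

Definition hom_mor V W (phi : lie2Hom V W) (m : morphisms V) : morphisms W :=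
  (hom0 phi m.1, hom1 phi m.2).

(* Image = kernel at the middle term, on objects and on morphisms. *)
Definition strictly_exact_at U V W (f : lie2Hom U V) (g : lie2Hom V W) : Prop :=
  range (hom0 f) = [set y | hom0 g y = 0] /\
  range (hom_mor f) = [set m | hom_mor g m = 0].

Section EL.
Variables (L : lmodType R) (br : lieBracket L).
Let B := lie_bilin br.

Let jacEL (x y z : L) : L := 0.

Fact jacEL_trilin : trilin jacEL.
Proof. by split=> u v a x x'; rewrite /jacEL scaler0 addr0. Qed.

Fact jacEL_anti (x y z x' y' z' : L) : jacEL x y z = - jacEL x' y' z'.
Proof. by rewrite /jacEL oppr0. Qed.

Fact jacEL_jac (x y z : L) :
  jacEL x y z = br x (br y z) + br (br x z) y - br (br x y) z.
Proof. by rewrite lie_jacobi3. Qed.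

Fact jacEL_coherence (w x y z : L) :
  br (jacEL w x y) z + jacEL (br w y) x z + jacEL w (br x y) z
    + br (jacEL w y z) x + br w (jacEL x y z) =
  jacEL (br w x) y z + br (jacEL w x z) y + jacEL w (br x z) y
    + jacEL (br w z) x y + jacEL w x (br y z).
Proof. by rewrite /jacEL !(bilin0l B) !(bilin0r B) !addr0. Qed.

(* The Lie 2-algebra E L of a Lie algebra L. *)
Definition EL : lie2Alg R :=
  @Lie2Alg R L L idfun br br br jacEL B B B jacEL_trilin (lie_anti br)
    (lie_anti br) (fun x y z => jacEL_anti x y z y x z)
    (fun x y z => jacEL_anti x y z x z y) (fun x h => erefl)
    (fun h h' => erefl) jacEL_jac jacEL_jac jacEL_coherence.
End EL.

(* The zero vector space is 'rV[R]_0. *)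
Definition zero_br (x y : 'rV[R]_0) : 'rV[R]_0 := 0.

Fact zero_br_bilin : bilin zero_br.
Proof. by split=> u a x x'; rewrite /zero_br scaler0 addr0. Qed.

Fact zero_br_jacobi (x y z : 'rV[R]_0) :
  zero_br x (zero_br y z) + zero_br y (zero_br z x) + zero_br z (zero_br x y)
  = 0.
Proof. by rewrite /zero_br !addr0. Qed.

Definition zeroLie : lieBracket 'rV[R]_0 :=
  LieBracket zero_br_bilin (fun=> erefl) zero_br_jacobi.

Fact zeromx_eq0 (x : 'rV[R]_0) : x = 0.
Proof. by apply/rowP; case. Qed.

Definition trivialL2 : lie2Alg R := EL zeroLie.

Lemma trivialL2_0 (x : deg0 trivialL2) : x = 0. Proof. exact: zeromx_eq0. Qed.
Lemma trivialL2_1 (x : deg1 trivialL2) : x = 0. Proof. exact: zeromx_eq0. Qed.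

End lie2_notions.

Section smooth_functions.
Variable R : realType.

Definition smooth1 (f : R -> R) : Prop :=
  forall n x, derivable (derive1n n f) x 1.

Lemma smooth1_derivable f x : smooth1 f -> derivable f x 1.
Proof. by move=> /(_ 0%N x). Qed.

Lemma smooth1_continuous f : smooth1 f -> continuous f.
Proof.
by move=> sf x; apply/differentiable_continuous/derivable1_diffP/smooth1_derivable.
Qed.

Lemma smooth1_derive1 f : smooth1 f -> smooth1 (derive1 f).
Proof. by move=> sf n x; rewrite -derive1Sn; exact: sf. Qed.

Lemma smooth1_ind (P : (R -> R) -> Prop) :
  (forall f, P f -> (forall x, derivable f x 1) /\ P (derive1 f)) ->
  forall f, P f -> smooth1 f.
Proof.
move=> Ps f Pf n; suff [] : P (derive1n n f) /\ True by move=> /Ps[].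
split=> //; elim: n => [//|n ih]; rewrite derive1nS; exact: (Ps _ ih).2.
Qed.

Lemma smooth1_cst a : smooth1 (cst a).
Proof.
apply: (smooth1_ind (P := fun f => exists a, f = cst a)); last by exists a.
move=> _ [b ->]; split=> [x|]; first exact: derivable_cst.
by exists 0; apply/funext=> x; rewrite derive1E derive_cst.
Qed.

Lemma derive1D (f g : R -> R) : smooth1 f -> smooth1 g ->
  derive1 (f + g) = derive1 f + derive1 g.
Proof.
move=> sf sg; apply/funext => x; rewrite derive1E.
by rewrite deriveD -?derive1E//; exact: smooth1_derivable.
Qed.

Lemma derive1M (f g : R -> R) : smooth1 f -> smooth1 g ->
  derive1 (f * g) = derive1 f * g + f * derive1 g.
Proof.
move=> sf sg; apply/funext => x; rewrite derive1E.
rewrite deriveM -?derive1E; try exact: smooth1_derivable.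
by rewrite addrC; congr (_ + _); exact: mulrC.
Qed.

Lemma smooth1D (f g : R -> R) : smooth1 f -> smooth1 g -> smooth1 (f + g).
Proof.
move=> sf sg.
apply: (smooth1_ind (P := fun h => exists f g,
  [/\ smooth1 f, smooth1 g & h = f + g])); last by exists f, g.
move=> _ [{}f [{}g [{}sf {}sg ->]]]; split=> [x|].
  by apply: derivableD; exact: smooth1_derivable.
by exists (derive1 f), (derive1 g); split; rewrite ?derive1D//; exact: smooth1_derive1.
Qed.

Lemma smooth1M (f g : R -> R) : smooth1 f -> smooth1 g -> smooth1 (f * g).
Proof.
have H : forall n (f g : R -> R), smooth1 f -> smooth1 g ->
  forall m, (m <= n)%N -> forall x, derivable (derive1n m (f * g)) x 1.
  elim=> [|n ih] {}f {}g sf sg m.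
    rewrite leqn0 => /eqP -> x; apply: derivableM; exact: smooth1_derivable.
  case: m => [_ x|m mn x]; first by apply: derivableM; exact: smooth1_derivable.
  rewrite derive1Sn derive1M//.
  have D : forall k (f g : R -> R),
     (forall m, (m <= k)%N -> forall x, derivable (derive1n m f) x 1) ->
     (forall m, (m <= k)%N -> forall x, derivable (derive1n m g) x 1) ->
     forall m, (m <= k)%N -> derive1n m (f + g) = derive1n m f + derive1n m g.
    move=> k f1 g1 f1k g1k; elim=> [//|j jh] jk.
    rewrite !derive1nS jh; last exact: ltnW.
    apply/funext => y; rewrite derive1E deriveD -?derive1E//.
      by apply: f1k; exact: ltnW.
    by apply: g1k; exact: ltnW.
  have i1 := ih _ _ (smooth1_derive1 sf) sg.
  have i2 := ih _ _ sf (smooth1_derive1 sg).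
  rewrite (D n _ _ i1 i2)//; apply: derivableD; [exact: i1|exact: i2].
by move=> sf sg n x; exact: (H n).
Qed.

Lemma smooth1Z a (f : R -> R) : smooth1 f -> smooth1 (a *: f).
Proof.
move=> sf; have -> : a *: f = (cst a : R -> R) * f by apply/funext.
by apply: smooth1M => //; exact: smooth1_cst.
Qed.

Lemma smooth1_sum (I : Type) (s : seq I) (F : I -> R -> R) :
  (forall i, smooth1 (F i)) -> smooth1 (\sum_(i <- s) F i).
Proof.
move=> sF; elim: s => [|i s ih]; rewrite ?big_nil ?big_cons.
  exact: smooth1_cst.
exact: smooth1D.
Qed.

Lemma derive1_sum (I : Type) (s : seq I) (F : I -> R -> R) :
  (forall i, smooth1 (F i)) ->
  derive1 (\sum_(i <- s) F i) = \sum_(i <- s) derive1 (F i).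
Proof.
move=> sF; elim: s => [|i s ih]; rewrite ?big_nil ?big_cons.
  by apply/funext=> x; rewrite derive1E derive_cst.
by rewrite derive1D ?ih//; exact: smooth1_sum.
Qed.

Lemma derive1Z a (f : R -> R) : smooth1 f -> derive1 (a *: f) = a *: derive1 f.
Proof.
move=> sf; apply/funext=> x; rewrite derive1E deriveZ -?derive1E//.
exact: smooth1_derivable.
Qed.

End smooth_functions.

Section smooth_vector.
Variables (R : realType) (V : vectType R).

(* V is finite-dimensional, so that smoothness and derivatives of a V-valued
   function are those of its scalar components; [vderiveE] shows that [vderive]
   does not depend on the basis. *)
Definition smooth (F : R -> V) : Prop :=
  forall u : {scalar V}, smooth1 (u \o F).

Definition vderive (F : R -> V) (t : R) : V :=
  \sum_(i < \dim {:V})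
    derive1 (coord (vbasis {:V}) i \o F) t *: (vbasis {:V})`_i.

Lemma smooth_expand (W : lmodType R) (u : {linear V -> W}) (v : V) :
  u v = \sum_(i < \dim {:V}) coord (vbasis {:V}) i v *: u (vbasis {:V})`_i.
Proof.
rewrite {1}(coord_vbasis (memvf v)) linear_sum.
by apply: eq_bigr => i _; rewrite linearZ.
Qed.

Lemma vderiveE (u : {scalar V}) F : smooth F ->
  u \o vderive F = derive1 (u \o F).
Proof.
move=> sF; have -> : u \o F = \sum_(i < \dim {:V})
    u (vbasis {:V})`_i *: (coord (vbasis {:V}) i \o F).
  apply/funext => t /=; rewrite smooth_expand fct_sumE; apply: eq_bigr => i _.
  exact: mulrC.
rewrite derive1_sum; last by move=> i; exact/smooth1Z/sF.
apply/funext => t; rewrite fct_sumE /= linear_sum; apply: eq_bigr => i _.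
by rewrite derive1Z ?linearZ//=; exact: mulrC.
Qed.

Lemma smooth_vderive F : smooth F -> smooth (vderive F).
Proof. by move=> sF u; rewrite vderiveE//; exact/smooth1_derive1/sF. Qed.

Lemma smoothP (a : R) F H : smooth F -> smooth H -> smooth (a *: F + H).
Proof.
move=> sF sH u; have -> : u \o (a *: F + H) = a *: (u \o F) + (u \o H).
  by apply/funext => t /=; rewrite [LHS]linearP.
by apply: smooth1D => //; exact: smooth1Z.
Qed.

Lemma smooth0 : smooth 0.
Proof.
move=> u; have -> : u \o (0 : R -> V) = cst 0; last exact: smooth1_cst.
by apply/funext => t /=; rewrite linear0.
Qed.

Lemma vectP (x y : V) : (forall u : {scalar V}, u x = u y) -> x = y.
Proof.
move=> xy; rewrite (coord_vbasis (memvf x)) (coord_vbasis (memvf y)).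
by apply: eq_bigr => i _; rewrite xy.
Qed.

Lemma vderiveP (a : R) F H : smooth F -> smooth H ->
  vderive (a *: F + H) = a *: vderive F + vderive H.
Proof.
move=> sF sH; apply/funext => t; apply: vectP => u.
rewrite -[LHS]/((u \o vderive (a *: F + H)) t) vderiveE; last exact: smoothP.
have -> : u \o (a *: F + H) = a *: (u \o F) + (u \o H).
  by apply/funext => s /=; rewrite [LHS]linearP.
rewrite derive1D//; last exact: smooth1Z.
by rewrite derive1Z// [RHS]linearP -!vderiveE.
Qed.

End smooth_vector.

Section bilinear_smooth.
Variables (R : realType) (V : vectType R).

Section scalar.
Variable f : V -> V -> R.
Hypothesis fb : bilin (f : V -> V -> R^o).

Lemma bilin_expand x y :
  f x y = \sum_(i < \dim {:V}) \sum_(j < \dim {:V})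
    f (vbasis {:V})`_i (vbasis {:V})`_j *
      (coord (vbasis {:V}) i x * coord (vbasis {:V}) j y).
Proof.
rewrite {1}(coord_vbasis (memvf x)) (bilin_suml fb); apply: eq_bigr => i _.
rewrite {1}(coord_vbasis (memvf y)) (bilin_sumr fb); apply: eq_bigr => j _.
by rewrite (bilinZl fb) (bilinZr fb) /GRing.scale /=; ring.
Qed.

Let cf i (F : R -> V) : R -> R := coord (vbasis {:V}) i \o F.

Let expandF F H : (fun t => f (F t) (H t)) =
  \sum_(i < \dim {:V}) \sum_(j < \dim {:V})
    f (vbasis {:V})`_i (vbasis {:V})`_j *: (cf i F * cf j H).
Proof.
apply/funext => t; rewrite bilin_expand fct_sumE; apply: eq_bigr => i _.
by rewrite fct_sumE.
Qed.

Lemma smooth_bilin1 F H : smooth F -> smooth H ->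
  smooth1 (fun t => f (F t) (H t)).
Proof.
move=> sF sH; rewrite expandF; apply: smooth1_sum => i; apply: smooth1_sum => j.
by apply/smooth1Z/smooth1M; [exact: sF|exact: sH].
Qed.

Lemma derive1_bilin F H : smooth F -> smooth H ->
  derive1 (fun t => f (F t) (H t)) =
  (fun t => f (vderive F t) (H t) + f (F t) (vderive H t)).
Proof.
move=> sF sH.
have s2 i j : smooth1 (cf i F * cf j H).
  by apply/smooth1M; [exact: sF|exact: sH].
rewrite expandF derive1_sum; last first.
  by move=> i; apply: smooth1_sum => j; exact: smooth1Z.
have -> : (fun t => f (vderive F t) (H t) + f (F t) (vderive H t)) =
   (fun t => f (vderive F t) (H t)) + (fun t => f (F t) (vderive H t)).
  by [].
rewrite !expandF -big_split; apply: eq_bigr => i _ /=.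
rewrite derive1_sum; last by move=> j; exact: smooth1Z.
rewrite -big_split; apply: eq_bigr => j _ /=.
rewrite derive1Z// derive1M; [|exact: sF|exact: sH].
by rewrite scalerDr /cf -!vderiveE.
Qed.

End scalar.

Lemma smooth_bilin (f : V -> V -> V) F H : bilin f -> smooth F -> smooth H ->
  smooth (fun t => f (F t) (H t)).
Proof.
move=> fb sF sH u.
apply: (@smooth_bilin1 (fun x y => u (f x y))) => //.
split=> w a x x'; first by rewrite (bilinDl fb) (bilinZl fb) [LHS]linearP.
by rewrite (bilinDr fb) (bilinZr fb) [LHS]linearP.
Qed.

Lemma vderive_bilin (f : V -> V -> V) F H : bilin f -> smooth F -> smooth H ->
  vderive (fun t => f (F t) (H t)) =
  (fun t => f (vderive F t) (H t) + f (F t) (vderive H t)).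
Proof.
move=> fb sF sH; apply/funext => t; apply: vectP => u.
have fub : bilin (fun x y => u (f x y) : R^o).
  split=> w a x x'; first by rewrite (bilinDl fb) (bilinZl fb) [LHS]linearP.
  by rewrite (bilinDr fb) (bilinZr fb) [LHS]linearP.
have sfb := smooth_bilin fb sF sH.
rewrite -[LHS]/((u \o vderive (fun t => f (F t) (H t))) t) vderiveE//.
by rewrite (derive1_bilin fub)// linearD.
Qed.

End bilinear_smooth.

Section paths.
Variables (R : realType) (V : vectType R).

Definition seg : Type := {t : R | 0 <= t <= 2 * pi}.

Fact seg_ge0 : 0 <= 2 * pi :> R.
Proof. by rewrite mulr_ge0 ?pi_ge0. Qed.

Definition seg0 : seg := exist _ 0 (introT andP (conj (lexx 0) seg_ge0)).
Definition seg1 : seg :=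
  exist _ (2 * pi) (introT andP (conj seg_ge0 (lexx (2 * pi)))).

(* P_0 V: maps [0, 2pi] -> V that are smooth up to the boundary, i.e. that are
   restrictions of smooth maps on the line, and vanish at 0. *)
Definition path_pred : {pred seg -> V} :=
  fun f => `[< (exists2 F : R -> V, smooth F & f = F \o val) /\ f seg0 = 0 >].

Fact path_submod : subsemimod_closed path_pred.
Proof.
split; first split.
- by apply/asboolP; split=> //; exists 0 => //; exact: smooth0.
- move=> f h /asboolP[[F sF fF] f0] /asboolP[[H sH hH] h0]; apply/asboolP.
  split; last by rewrite -[LHS]/(f seg0 + h seg0) f0 h0 addr0.
  exists (F + H); last by rewrite fF hH.
  by rewrite -[F]scale1r; exact: smoothP.
- move=> a f /asboolP[[F sF fF] f0]; apply/asboolP.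
  split; last by rewrite -[LHS]/(a *: f seg0) f0 scaler0.
  exists (a *: F); last by rewrite fF.
  rewrite -[_ *: F]addr0; apply: smoothP => //.
  exact: smooth0.
Qed.

HB.instance Definition _ :=
  GRing.isSubmodClosed.Build R (seg -> V) path_pred path_submod.

Record path0 : Type := Path0 {
  path_val :> seg -> V;
  path_valP : path_val \in path_pred
}.

HB.instance Definition _ := [isSub for path_val].
HB.instance Definition _ := [Choice of path0 by <:].
HB.instance Definition _ := [SubChoice_isSubLmodule of path0 by <:].

(* Omega V, as a subspace of P_0 V. *)
Definition loop_pred : {pred path0} := fun p => p seg1 == 0.

Fact loop_submod : subsemimod_closed loop_pred.
Proof.
split; first split; rewrite /in_mem/= /loop_pred//.
- by move=> p q /eqP p0 /eqP q0; apply/eqP; rewrite -[LHS]/(p seg1 + q seg1) p0 q0 addr0.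
- by move=> a p /eqP p0; apply/eqP; rewrite -[LHS]/(a *: p seg1) p0 scaler0.
Qed.

HB.instance Definition _ :=
  GRing.isSubmodClosed.Build R path0 loop_pred loop_submod.

Record loop0 : Type := Loop0 {
  loop_val :> path0;
  loop_valP : loop_val \in loop_pred
}.

HB.instance Definition _ := [isSub for loop_val].
HB.instance Definition _ := [Choice of loop0 by <:].
HB.instance Definition _ := [SubChoice_isSubLmodule of loop0 by <:].

Lemma path_eq (p q : path0) : (forall t, p t = q t) -> p = q.
Proof. by move=> pq; apply/val_inj/funext. Qed.

Lemma loop_eq (l m : loop0) : (forall t, l t = m t) -> l = m.
Proof. by move=> lm; apply/val_inj/path_eq. Qed.

Lemma path_start (p : path0) : p seg0 = 0.
Proof. by case: p => p /= /asboolP[]. Qed.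

Lemma loop_end (l : loop0) : l seg1 = 0.
Proof. by case: l => l /= /eqP. Qed.

Lemma path_smooth (p : path0) : exists2 F, smooth F & path_val p = F \o val.
Proof. by case: p => p /= /asboolP[]. Qed.

(* A chosen smooth extension to the line: on [0, 2pi] its values and its
   derivative, endpoints included, are those of p whatever the choice
   (see also [cocycleE]). *)
Definition smooth_ext (p : path0) : R -> V := s2val (cid2 (path_smooth p)).

Lemma smooth_extP (p : path0) : smooth (smooth_ext p).
Proof. exact: s2valP (cid2 (path_smooth p)). Qed.

Lemma smooth_extE (p : path0) (t : seg) : smooth_ext p (val t) = p t.
Proof. by have := s2valP' (cid2 (path_smooth p)) => /(congr1 (@^~ t)). Qed.

End paths.

Arguments smooth_extP {R V} p u n x.

(* Invariant symmetric bilinear forms. *)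
Record invForm (R : realType) (g : vectType R) (br : lieBracket g) := InvForm {
  form :> g -> g -> R;
  form_bilin : bilin (form : g -> g -> R^o);
  form_sym : forall x y, form x y = form y x;
  form_inv : forall x y z, form (br x y) z = form x (br y z)
}.

Section form_lemmas.
Variables (R : realType) (g : vectType R) (br : lieBracket g).

Section scale.
Variables (a : R) (B : invForm br).

Let aB (x y : g) : R := a * B x y.

Fact scale_form_bilin : bilin (aB : g -> g -> R^o).
Proof.
split=> u b x x'; rewrite /aB.
  by rewrite (bilinDl (form_bilin B)) (bilinZl (form_bilin B)) /GRing.scale/=; ring.
by rewrite (bilinDr (form_bilin B)) (bilinZr (form_bilin B)) /GRing.scale/=; ring.
Qed.

Fact scale_form_sym x y : aB x y = aB y x.
Proof. by rewrite /aB form_sym. Qed.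

Fact scale_form_inv x y z : aB (br x y) z = aB x (br y z).
Proof. by rewrite /aB form_inv. Qed.

Definition scale_form : invForm br :=
  InvForm scale_form_bilin scale_form_sym scale_form_inv.
End scale.

Variable B : invForm br.

Lemma form_cycle x y z : B x (br y z) = B y (br z x).
Proof. by rewrite -[RHS]form_inv form_sym. Qed.

Lemma form_swap x y z : B x (br y z) = - B y (br x z).
Proof.
rewrite form_cycle (lie_anti br z x) (bilinNr (form_bilin B)).
by [].
Qed.

End form_lemmas.

Section gk.
Variables (R : realType) (g : vectType R) (br : lieBracket g) (B : invForm br).
Variable k : int.
Let bb := lie_bilin br.
Let fb := form_bilin B.

Let zdif : {linear R^o -> g} := \0.
Let zbr01 (x : g) (c : R^o) : R^o := 0.
Let zbr10 (c : R^o) (x : g) : R^o := 0.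
Definition gk_jac (x y z : g) : R^o := k%:~R * B x (br y z).

Fact gk_bilin01 : bilin zbr01.
Proof. by split=> u a x x'; rewrite /zbr01 scaler0 addr0. Qed.

Fact gk_bilin10 : bilin zbr10.
Proof. by split=> u a x x'; rewrite /zbr10 scaler0 addr0. Qed.

Fact gk_trilin : trilin gk_jac.
Proof.
split=> u v a x x'; rewrite /gk_jac.
- by rewrite (bilinDl fb) (bilinZl fb) /GRing.scale/=; ring.
- by rewrite (bilinDl bb) (bilinZl bb) (bilinDr fb) (bilinZr fb) /GRing.scale/=; ring.
- by rewrite (bilinDr bb) (bilinZr bb) (bilinDr fb) (bilinZr fb) /GRing.scale/=; ring.
Qed.

Fact gk_br01_anti x h : zbr01 x h = - zbr10 h x.
Proof. by rewrite /zbr01 /zbr10 oppr0. Qed.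

Fact gk_anti12 x y z : gk_jac x y z = - gk_jac y x z.
Proof. by rewrite /gk_jac form_swap mulrN. Qed.

Fact gk_anti23 x y z : gk_jac x y z = - gk_jac x z y.
Proof. by rewrite /gk_jac (lie_anti br y z) (bilinNr fb) mulrN. Qed.

Fact gk_dif_br01 x h : zdif (zbr01 x h) = br x (zdif h).
Proof. by rewrite /= (bilin0r bb). Qed.

Fact gk_dif_jac x y z :
  zdif (gk_jac x y z) = br x (br y z) + br (br x z) y - br (br x y) z.
Proof. by rewrite lie_jacobi3. Qed.

Fact gk_jac_dif x y h :
  gk_jac x y (zdif h) = zbr01 x (zbr01 y h) + zbr10 (zbr01 x h) y - zbr01 (br x y) h.
Proof. by rewrite /gk_jac /= (bilin0r bb) (bilin0r fb) mulr0 /zbr01 /zbr10 !addr0 subr0. Qed.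

Fact gk_coherence w x y z :
  zbr10 (gk_jac w x y) z + gk_jac (br w y) x z + gk_jac w (br x y) z
    + zbr10 (gk_jac w y z) x + zbr01 w (gk_jac x y z) =
  gk_jac (br w x) y z + zbr10 (gk_jac w x z) y + gk_jac w (br x z) y
    + gk_jac (br w z) x y + gk_jac w x (br y z).
Proof.
rewrite /zbr10 /zbr01 /gk_jac !add0r !addr0.
rewrite (lie_anti br (br x y) z) (lie_anti br (br x z) y).
rewrite !(bilinNr fb) -(form_inv B w z) -(form_inv B w y) -(form_inv B w x).
have : B (br w x) (br y z) + B (br w y) (br z x) + B (br w z) (br x y) = 0.
  rewrite !form_inv -!(bilinDr fb) lie_jacobi; exact: (bilin0r fb).
rewrite (lie_anti br z x) (bilinNr fb).
set a := B _ _; set b := B _ _; set c := B _ _ => abc.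
have -> : a = b - c by apply/eqP; rewrite -subr_eq0 -abc; apply/eqP; ring.
ring.
Qed.

Definition gk : lie2Alg R :=
  @Lie2Alg R g R^o zdif br zbr01 zbr10 gk_jac bb gk_bilin01 gk_bilin10
    gk_trilin (lie_anti br) gk_br01_anti gk_anti12 gk_anti23 gk_dif_br01
    (fun _ _ => erefl) gk_dif_jac gk_jac_dif gk_coherence.
End gk.

Section path_algebra.
Variables (R : realType) (g : vectType R) (br : lieBracket g).
Let bb := lie_bilin br.
Let P := path0 g.
Let L := loop0 g.

Fact path_brP (p q : P) : (fun t => br (p t) (q t)) \in @path_pred R g.
Proof.
apply/asboolP; split; last by rewrite path_start (bilin0l bb).
exists (fun t => br (smooth_ext p t) (smooth_ext q t)).
  by apply: smooth_bilin; [exact: bb|exact: smooth_extP..].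
by apply/funext => t /=; rewrite !smooth_extE.
Qed.

Definition path_br (p q : P) : P := Path0 (path_brP p q).

Fact path_br_bilin : bilin path_br.
Proof.
split=> u a x x'; apply: path_eq => t /=.
  by rewrite (bilinDl bb) (bilinZl bb).
by rewrite (bilinDr bb) (bilinZr bb).
Qed.

Fact path_br_alt p : path_br p p = 0.
Proof. by apply: path_eq => t /=; rewrite lie_alt. Qed.

Fact path_br_jacobi x y z : path_br x (path_br y z) + path_br y (path_br z x)
  + path_br z (path_br x y) = 0.
Proof. by apply: path_eq => t /=; rewrite -[RHS](lie_jacobi br (x t) (y t) (z t)). Qed.

Definition pathLie : lieBracket P :=
  LieBracket path_br_bilin path_br_alt path_br_jacobi.

Fact loop_brP (p : P) (l : L) : path_br p l \in @loop_pred R g.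
Proof. by apply/eqP; rewrite /= loop_end (bilin0r bb). Qed.

Definition path_loop_br (p : P) (l : L) : L := Loop0 (loop_brP p l).

Definition loop_br (l m : L) : L := path_loop_br l m.

Fact loop_br_bilin : bilin loop_br.
Proof.
split=> u a x x'; apply: loop_eq => t /=.
  by rewrite (bilinDl bb) (bilinZl bb).
by rewrite (bilinDr bb) (bilinZr bb).
Qed.

Fact loop_br_alt p : loop_br p p = 0.
Proof. by apply: loop_eq => t /=; rewrite lie_alt. Qed.

Fact loop_br_jacobi x y z : loop_br x (loop_br y z) + loop_br y (loop_br z x)
  + loop_br z (loop_br x y) = 0.
Proof. by apply: loop_eq => t /=; rewrite -[RHS](lie_jacobi br (x t) (y t) (z t)). Qed.

Definition loopLie : lieBracket L :=
  LieBracket loop_br_bilin loop_br_alt loop_br_jacobi.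

Variable B : invForm br.
Let fb := form_bilin B.

(* The integral of <l(t), p'(t)> over [0, 2pi]. *)
Definition cocycle (l p : P) : R :=
  \int[lebesgue_measure]_(t in `[0, 2 * pi])
    B (smooth_ext l t) (vderive (smooth_ext p) t).

Lemma pi2_gt0 : 0 < 2 * pi :> R.
Proof. by rewrite mulr_gt0 ?pi_gt0. Qed.

Lemma smooth1_integrable (f : R -> R) : smooth1 f ->
  (@lebesgue_measure R).-integrable `[0, 2 * pi] (EFin \o f).
Proof.
move=> sf; apply: continuous_compact_integrable; first exact: segment_compact.
exact/continuous_subspaceT/smooth1_continuous.
Qed.

Lemma smooth1_integrable_oo (f : R -> R) : smooth1 f ->
  (@lebesgue_measure R).-integrable `]0, 2 * pi[ (EFin \o f).
Proof.
move=> sf; apply: integrableS (smooth1_integrable sf) => //.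
exact: subset_itv_oo_cc.
Qed.

Lemma smooth1_integral_oo (f : R -> R) : smooth1 f ->
  \int[lebesgue_measure]_(t in `[0, 2 * pi]) f t =
  \int[lebesgue_measure]_(t in `]0, 2 * pi[) f t.
Proof.
move=> sf; rewrite Rintegral_itv_obnd_cbnd; last exact: smooth1_integrable_oo.
rewrite Rintegral_itv_bndo_bndc//.
apply: integrableS (smooth1_integrable sf) => //.
exact: subset_itv_co_cc.
Qed.

Lemma smooth1_FTC (f : R -> R) : smooth1 f ->
  \int[lebesgue_measure]_(t in `[0, 2 * pi]) (derive1 f) t = f (2 * pi) - f 0.
Proof.
move=> sf; rewrite /Rintegral (@continuous_FTC2 _ _ f)//.
- exact: pi2_gt0.
- exact/continuous_subspaceT/smooth1_continuous/smooth1_derive1.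
- split=> [x _||]; first exact: smooth1_derivable.
  + exact/cvg_at_right_filter/smooth1_continuous.
  + exact/cvg_at_left_filter/smooth1_continuous.
Qed.

Lemma vderive_locally (F H : R -> g) a b :
  (forall t, a < t < b -> F t = H t) ->
  forall t, a < t < b -> vderive F t = vderive H t.
Proof.
move=> FH t tab; apply: eq_bigr => i _; congr (_ *: _).
rewrite !derive1E; apply: near_eq_derive.
have : t \in `]a, b[ by rewrite in_itv.
move=> /near_in_itvoo; apply: filterS => s; rewrite in_itv /= => sab.
by rewrite FH.
Qed.

Lemma smooth_cocycle F H : smooth F -> smooth H ->
  smooth1 (fun t => B (F t) (vderive H t)).
Proof. by move=> sF sH; apply: (smooth_bilin1 fb) => //; exact: smooth_vderive. Qed.

Lemma cocycleE (l p : P) F H : smooth F -> smooth H ->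
  (forall t : seg R, l t = F (val t)) -> (forall t : seg R, p t = H (val t)) ->
  cocycle l p =
  \int[lebesgue_measure]_(t in `[0, 2 * pi]) B (F t) (vderive H t).
Proof.
move=> sF sH lF pH; rewrite /cocycle !smooth1_integral_oo.
- apply: eq_Rintegral => t; rewrite inE /= in_itv /= => tI.
  have ext (q : P) G s : (forall t : seg R, q t = G (val t)) -> 0 < s < 2 * pi ->
      smooth_ext q s = G s.
    move=> qG /andP[s0 s1]; have sI : 0 <= s <= 2 * pi by rewrite !ltW.
    by rewrite -[s]/(val (exist (fun t : R => 0 <= t <= 2 * pi) s sI)) smooth_extE qG.
  congr (B _ _); first exact: ext.
  by apply: (vderive_locally _ tI) => s; exact: ext.
- exact: smooth_cocycle.
- by apply: smooth_cocycle; exact: smooth_extP.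
Qed.

Lemma RintegralP (a : R) (f h : R -> R) : smooth1 f -> smooth1 h ->
  \int[lebesgue_measure]_(t in `[0, 2 * pi]) (a * f t + h t) =
  a * (\int[lebesgue_measure]_(t in `[0, 2 * pi]) f t) +
  \int[lebesgue_measure]_(t in `[0, 2 * pi]) h t.
Proof.
move=> sf sh; rewrite RintegralD//; last exact: smooth1_integrable.
  by rewrite RintegralZl//; exact: smooth1_integrable.
exact/(smooth1_integrable (f := a *: f))/smooth1Z.
Qed.

Lemma cocycle_bilin : bilin (cocycle : P -> P -> R^o).
Proof.
split=> u a x x' /=.
- rewrite (@cocycleE _ _ (a *: smooth_ext x + smooth_ext x') (smooth_ext u)).
  + rewrite -RintegralP; try by apply: smooth_cocycle; exact: smooth_extP.
    by apply: eq_Rintegral => t _ /=; rewrite (bilinDl fb) (bilinZl fb).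
  + by apply: smoothP; exact: smooth_extP.
  + exact: smooth_extP.
  + by move=> t; rewrite -[LHS]/(a *: x t + x' t) -!smooth_extE.
  + by move=> t; rewrite smooth_extE.
- rewrite (@cocycleE _ _ (smooth_ext u) (a *: smooth_ext x + smooth_ext x')).
  + rewrite -RintegralP; try by apply: smooth_cocycle; exact: smooth_extP.
    apply: eq_Rintegral => t _ /=.
    rewrite vderiveP; try exact: smooth_extP.
    by rewrite (bilinDr fb) (bilinZr fb).
  + exact: smooth_extP.
  + by apply: smoothP; exact: smooth_extP.
  + by move=> t; rewrite smooth_extE.
  + by move=> t; rewrite -[LHS]/(a *: x t + x' t) -!smooth_extE.
Qed.

Lemma cocycle_parts (p q : P) :
  cocycle p q + cocycle q p = B (p (seg1 R)) (q (seg1 R)).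
Proof.
have [sp sq] := (smooth_extP p, smooth_extP q).
have p0 : smooth_ext p 0 = 0.
  by have := smooth_extE p (seg0 R); rewrite path_start.
have p1 : smooth_ext p (2 * pi) = p (seg1 R) := smooth_extE p (seg1 R).
have q1 : smooth_ext q (2 * pi) = q (seg1 R) := smooth_extE q (seg1 R).
have := smooth1_FTC (smooth_bilin1 fb sp sq).
rewrite p0 p1 q1 (bilin0l fb) subr0 => <-.
rewrite (derive1_bilin fb)// /cocycle addrC.
rewrite -[X in X + _]mul1r -RintegralP; try exact: smooth_cocycle.
by apply: eq_Rintegral => t _; rewrite mul1r form_sym.
Qed.

Lemma cocycle_loop (l m : L) : cocycle l m = - cocycle m l.
Proof.
apply/eqP; rewrite -subr_eq0 opprK; apply/eqP.
by rewrite cocycle_parts loop_end (bilin0l fb).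
Qed.

Lemma cocycle_br (l x y : P) :
  cocycle l (path_br x y) = cocycle (path_br y l) x - cocycle (path_br x l) y.
Proof.
have [sl sx sy] := And3 (smooth_extP l) (smooth_extP x) (smooth_extP y).
pose b (F H : R -> g) t := br (F t) (H t).
have sb F H : smooth F -> smooth H -> smooth (b F H).
  by move=> sF sH; exact: (smooth_bilin bb).
have E p q t : path_br p q t = b (smooth_ext p) (smooth_ext q) (val t).
  by rewrite /b !smooth_extE.
have E' (p : P) t : p t = smooth_ext p (val t) by rewrite smooth_extE.
rewrite (cocycleE sl (sb _ _ sx sy) (E' l) (E x y)).
rewrite (cocycleE (sb _ _ sy sl) sx (E y l) (E' x)).
rewrite (cocycleE (sb _ _ sx sl) sy (E x l) (E' y)).
rewrite addrC -mulN1r -RintegralP; last 2 first.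
- by apply: smooth_cocycle => //; exact: sb.
- by apply: smooth_cocycle => //; exact: sb.
apply: eq_Rintegral => t _; rewrite /b (vderive_bilin bb)// (bilinDr fb).
rewrite addrC mulN1r -(bilinNl fb) -lie_anti form_inv.
by rewrite [X in _ + X = _]form_cycle [X in _ + X = _]form_sym.
Qed.

Variable k : int.

Definition Pk_deg1 : lmodType R := (L * R^o)%type.

Definition Pk_br01 (p : P) (h : Pk_deg1) : Pk_deg1 :=
  (path_loop_br p h.1, 2 * k%:~R * cocycle h.1 p).

Definition Pk_br10 (h : Pk_deg1) (p : P) : Pk_deg1 := - Pk_br01 p h.

Let Pk_jac (x y z : P) : Pk_deg1 := 0.
Definition Pk_dif0 (h : Pk_deg1) : P := h.1.

Fact Pk_dif_linear : linear Pk_dif0.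
Proof. by []. Qed.

HB.instance Definition _ :=
  GRing.isLinear.Build R Pk_deg1 P _ Pk_dif0 Pk_dif_linear.

Let cb := cocycle_bilin.

Fact Pk_br01_bilin : bilin Pk_br01.
Proof.
split=> u a x x'; apply: injective_projections; rewrite /=.
- by apply: loop_eq => t /=; rewrite (bilinDl bb) (bilinZl bb).
- have -> : cocycle u.1 (a *: x + x') = a * cocycle u.1 x + cocycle u.1 x'.
    exact: cb.2.
  by rewrite mulrDr mulrCA.
- by apply: loop_eq => t /=; rewrite (bilinDr bb) (bilinZr bb).
- have -> : cocycle (a *: x.1 + x'.1) u = a * cocycle x.1 u + cocycle x'.1 u.
    exact: (cb.1 u a (val x.1) (val x'.1)).
  by rewrite mulrDr mulrCA.
Qed.

Fact Pk_br10_bilin : bilin Pk_br10.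
Proof.
split=> u a x x'; rewrite /Pk_br10.
  by rewrite (Pk_br01_bilin.2 u a) opprD scalerN.
by rewrite (Pk_br01_bilin.1 u a) opprD scalerN.
Qed.

Fact Pk_jac_trilin : trilin Pk_jac.
Proof. by split=> u v a x x'; rewrite /Pk_jac scaler0 addr0. Qed.

Fact Pk_br01_anti x h : Pk_br01 x h = - Pk_br10 h x.
Proof. by rewrite /Pk_br10 opprK. Qed.

Fact Pk_jac_anti (x y z x' y' z' : P) : Pk_jac x y z = - Pk_jac x' y' z'.
Proof. by rewrite /Pk_jac oppr0. Qed.

Fact Pk_peiffer h h' : Pk_br01 (Pk_dif0 h) h' = Pk_br10 h (Pk_dif0 h').
Proof.
apply: injective_projections; rewrite /=.
- by apply: loop_eq => t /=; rewrite lie_anti.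
- by rewrite cocycle_loop mulrN.
Qed.

Fact Pk_dif_jac x y z :
  Pk_dif0 (Pk_jac x y z) =
  path_br x (path_br y z) + path_br (path_br x z) y - path_br (path_br x y) z.
Proof. by rewrite (lie_jacobi3 pathLie). Qed.

Fact Pk_jac_dif x y h :
  Pk_jac x y (Pk_dif0 h) =
  Pk_br01 x (Pk_br01 y h) + Pk_br10 (Pk_br01 x h) y - Pk_br01 (path_br x y) h.
Proof.
apply: injective_projections; rewrite /=.
- apply: loop_eq => t /=.
  rewrite !fctE -(lie_anti br (br (x t) (h.1 t)) (y t)).
  by rewrite lie_jacobi3.
- have := cocycle_br h.1 x y.
  set a := cocycle _ _; set b := cocycle _ _; set c := cocycle _ _ => ->.
  by rewrite mulrBr subrr.
Qed.

Fact Pk_coherence w x y z :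
  Pk_br10 (Pk_jac w x y) z + Pk_jac (path_br w y) x z
    + Pk_jac w (path_br x y) z + Pk_br10 (Pk_jac w y z) x
    + Pk_br01 w (Pk_jac x y z) =
  Pk_jac (path_br w x) y z + Pk_br10 (Pk_jac w x z) y
    + Pk_jac w (path_br x z) y + Pk_jac (path_br w z) x y
    + Pk_jac w x (path_br y z).
Proof.
by rewrite /Pk_jac !(bilin0l Pk_br10_bilin) (bilin0r Pk_br01_bilin) !addr0.
Qed.

Definition Pk : lie2Alg R :=
  @Lie2Alg R P Pk_deg1 Pk_dif0 path_br Pk_br01 Pk_br10 Pk_jac
    path_br_bilin Pk_br01_bilin Pk_br10_bilin Pk_jac_trilin (lie_anti pathLie)
    Pk_br01_anti (fun x y z => Pk_jac_anti x y z y x z)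
    (fun x y z => Pk_jac_anti x y z x z y) (fun x h => erefl)
    Pk_peiffer Pk_dif_jac Pk_jac_dif Pk_coherence.

End path_algebra.

Section lie_groups.
Variable R : realType.

(* Meant for U open and V finite-dimensional: f is C^k on U. *)
Fixpoint Ck (V W : normedModType R) (k : nat) (U : set V) (f : V -> W) : Prop :=
  (forall x, U x -> {for x, continuous f}) /\
  if k is k'.+1 then
    forall v, (forall x, U x -> derivable f x v) /\ Ck k' U (fun x => 'D_v f x)
  else True.

Definition smooth_on (V W : normedModType R) (U : set V) (f : V -> W) : Prop :=
  forall k, Ck k U f.

(* [chart_map] and [chart_inv] are total functions, only meaningful on
   [chart_dom] and on its image. *)
Record chart (T : topologicalType) (n : nat) := Chart {
  chart_dom : set T;
  chart_map :> T -> 'rV[R]_n;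
  chart_inv : 'rV[R]_n -> T;
  chart_dom_open : open chart_dom;
  chart_im_open : open (chart_map @` chart_dom);
  chart_mapK : forall x, chart_dom x -> chart_inv (chart_map x) = x;
  chart_map_continuous : forall x, chart_dom x -> {for x, continuous chart_map};
  chart_inv_continuous : forall v, (chart_map @` chart_dom) v ->
    {for v, continuous chart_inv}
}.

(* A real Lie group of dimension n; any smooth atlas is allowed, not only the
   maximal one. *)
Record lieGroup (n : nat) := LieGroup {
  lg_space :> topologicalType;
  lg_one : lg_space;
  lg_mul : lg_space -> lg_space -> lg_space;
  lg_inv : lg_space -> lg_space;
  lg_mulA : associative lg_mul;
  lg_mul1 : left_id lg_one lg_mul;
  lg_mulV : left_inverse lg_one lg_inv lg_mul;
  lg_hausdorff : hausdorff_space lg_space;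
  lg_second_countable : @second_countable lg_space;
  lg_atlas : set (chart lg_space n);
  lg_cover : forall x, exists2 c, lg_atlas c & chart_dom c x;
  lg_transition : forall b c, lg_atlas b -> lg_atlas c ->
    smooth_on (b @` (chart_dom b `&` chart_dom c)) (c \o chart_inv b);
  lg_mul_continuous : continuous (fun p : lg_space * lg_space => lg_mul p.1 p.2);
  lg_inv_continuous : continuous lg_inv;
  lg_mul_smooth : forall a b c, lg_atlas a -> lg_atlas b -> lg_atlas c ->
    smooth_on
      [set v : 'rV[R]_n * 'rV[R]_n | exists x y,
        [/\ chart_dom a x, chart_dom b y, chart_dom c (lg_mul x y)
          & v = (a x, b y)]]
      (fun v => c (lg_mul (chart_inv a v.1) (chart_inv b v.2)));
  lg_inv_smooth : forall b c, lg_atlas b -> lg_atlas c ->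
    smooth_on (b @` (chart_dom b `&` lg_inv @^-1` chart_dom c))
      (fun v => c (lg_inv (chart_inv b v)))
}.

Arguments lg_one {n} l.
Arguments lg_atlas {n} l.

(* Path-connected, and every loop contracts relative to its base point. *)
Definition simply_connected (T : topologicalType) : Prop :=
  (forall x y : T, exists2 gam : R -> T,
     {within `[0, 1], continuous gam} & gam 0 = x /\ gam 1 = y) /\
  (forall gam : R -> T, {within `[0, 1], continuous gam} -> gam 0 = gam 1 ->
     exists2 H : R * R -> T, {within `[0, 1] `*` `[0, 1], continuous H} &
       [/\ forall s, s \in `[0, 1] -> H (0, s) = gam s,
           forall s, s \in `[0, 1] -> H (1, s) = gam 0
         & forall r, r \in `[0, 1] -> H (r, 0) = gam 0 /\ H (r, 1) = gam 0]).

Section lie_algebra.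
Variables (n : nat) (G : lieGroup n).

Definition chart_mul (c : chart G n) (v : 'rV[R]_n * 'rV[R]_n) : 'rV[R]_n :=
  c (lg_mul (chart_inv c v.1) (chart_inv c v.2)).

(* The Lie bracket on the tangent space at 1, in a chart around 1: if
   b(u, v) is the mixed second derivative at the identity of the multiplication
   in the direction u of its first and v of its second argument, then
   [u, v] = b(u, v) - b(v, u).  For a matrix group this is uv - vu. *)
Definition chart_bracket (c : chart G n) (u v : 'rV[R]_n) : 'rV[R]_n :=
  let e := (c (lg_one G), c (lg_one G)) in
  'D_(u, 0) (fun w => 'D_(0, v) (chart_mul c) w) e -
  'D_(v, 0) (fun w => 'D_(0, u) (chart_mul c) w) e.

Definition lie_algebra_of (g : vectType R) (br : lieBracket g) : Prop :=
  exists2 c : chart G n, lg_atlas G c /\ chart_dom c (lg_one G) &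
  exists2 iota : {linear g -> 'rV[R]_n}, bijective iota &
  forall x y, iota (br x y) = chart_bracket c (iota x) (iota y).

End lie_algebra.
End lie_groups.

Section basic_inner_product.
Variables (R : realType) (g : vectType R) (br : lieBracket g).

(* A simple Lie group is a connected one whose Lie algebra is simple. *)
Definition simple_lie : Prop :=
  (exists x y, br x y <> 0) /\
  (forall I : {vspace g}, (forall x y, y \in I -> br x y \in I) ->
     I = 0%VS \/ I = fullv).

(* For the Lie algebra of a compact group: Lie algebras of maximal tori. *)
Definition maximal_abelian (t : {vspace g}) : Prop :=
  (forall x y, x \in t -> y \in t -> br x y = 0) /\
  (forall x, (forall y, y \in t -> br x y = 0) -> x \in t).

Section roots.
Variable t : {vspace g}.
Implicit Type alpha : 'Hom(subvs_of t, R^o).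

(* Roots of a compact Lie algebra are taken real-valued: x + i y in the
   complexification satisfies [h, x + i y] = i alpha(h) (x + i y). *)
Definition root_vector alpha (x y : g) : Prop :=
  forall h : subvs_of t,
    br (vsval h) x = - alpha h *: y /\ br (vsval h) y = alpha h *: x.

Definition is_root alpha : Prop :=
  alpha <> 0 /\ exists x y, root_vector alpha x y /\ (x, y) <> (0, 0).

Definition regular (h0 : subvs_of t) : Prop :=
  forall alpha, is_root alpha -> alpha h0 <> 0.

Definition positive_root (h0 : subvs_of t) alpha : Prop :=
  is_root alpha /\ 0 < alpha h0.

(* The positive roots are those with alpha(h0) > 0, for a regular h0; theta is
   highest when theta - alpha is a sum of positive roots for every root alpha. *)
Definition highest_root (h0 : subvs_of t) theta : Prop :=
  is_root theta /\
  forall alpha, is_root alpha ->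
    exists2 s : seq 'Hom(subvs_of t, R^o),
      forall beta, beta \in s -> positive_root h0 beta
      & theta - alpha = \sum_(beta <- s) beta.

(* With real-valued roots the coroot lies in t itself: it is the h in
   [g_alpha, g_(- alpha)] with alpha(h) = 2, and that line meets g in the
   multiples of [x, y], as [x + i y, x - i y] = - 2 i [x, y]. *)
Definition is_coroot alpha (h : subvs_of t) : Prop :=
  alpha h = 2 /\
  exists x y (c : R), root_vector alpha x y /\ vsval h = c *: br x y.

End roots.

(* All pairs (t, Weyl chamber) are conjugate, so the normalisation may be asked
   for one of them.  With the coroot in g rather than in i g it is compatible
   with positivity: for su(n) this is the form - tr(xy). *)
Definition basic_inner_product (B : invForm br) : Prop :=
  (forall x, x != 0 -> 0 < B x x) /\
  exists t : {vspace g}, maximal_abelian t /\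
  exists h0 : subvs_of t, regular h0 /\
  exists theta h, [/\ highest_root h0 theta, is_coroot theta h
                    & B (vsval h) (vsval h) = 2].

End basic_inner_product.

(* Main.v *)
Require Import Defs.
From HB Require Import structures.
From mathcomp Require Import all_boot all_order all_algebra.
From mathcomp Require Import all_classical all_reals all_analysis.
From mathcomp Require Import ring lra.

Set Implicit Arguments.
Unset Strict Implicit.
Unset Printing Implicit Defensive.

Import Order.TTheory GRing.Theory Num.Theory.
Import numFieldNormedType.Exports.

Local Open Scope classical_set_scope.
Local Open Scope ring_scope.

(** Everything is explicit once the right homotopies are known.  Write c(p, q)
    for [cocycle], the integral of <p, q'> over [0, 2pi].

    A path is sent to its endpoint, and a morphism to its central component;
    this is onto g_k, and its kernel, the loops on objects and the loops with
    zero central component in degree 1, is E (Omega g).  Neither the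
    inclusion of E (Omega g) nor the evaluation respects the brackets
    strictly: the first is corrected by 2k c(l, m), which is the Kac-Moody
    cocycle, and the second by k (c(q, p) - c(p, q)).
    Integration by parts, c(p, q) + c(q, p) = <p(2pi), q(2pi)>, together with
    the cocycle identity gives the cyclic sum of c(p, [q, r]) as twice
    <p(2pi), [q(2pi), r(2pi)]> ([cocycle_br_sum]).  For loops this is zero,
    which is the coherence law of the inclusion; for paths it produces
    the l_3 of g_k, which is the coherence law of the evaluation.

    E L is contractible because its differential is the identity, which is
    then a homotopy from zero to the identity homomorphism ([EL_trivial]).

    A quasi-inverse of the evaluation sends x to the ray f x, where
    f(t) = t / 2pi.  The bracket of two rays is f^2 [x, y] and not f [x, y];
    the loop (f - f^2) [x, y] makes up for the difference.  Its coherence law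
    holds because (f - f^2) f' has integral 1/6: the cyclic sum of three equal
    terms with factor 2k/6 is the l_3 of g_k.  Evaluating a ray gives x back
    on the nose ([eval_ray]), and a path p differs from the ray with its
    endpoint by the loop p - f p(2pi), which is the 2-homomorphism in the
    other direction ([ray_eval]). *)

(** * Contractibility of E L *)

Section contractible.
Variables (R : realType) (L : lmodType R) (br : lieBracket L).

(** The two composites with the zero homomorphisms are zero, and since
    d = id on E L, the 2-homomorphism from zero to the identity is id itself. *)
Lemma EL_trivial : lie2_equivalent (EL br) (trivialL2 R).
Proof.
exists (zeroL2 _ _), (zeroL2 _ _); split.
  exists \0; split=> *; first by rewrite [LHS]trivialL2_0 [RHS]trivialL2_0.
    by rewrite [LHS]trivialL2_1 [RHS]trivialL2_1.
  by rewrite [LHS]trivialL2_1 [RHS]trivialL2_1.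
exists idfun; split=> [x|x|x y] /=; rewrite ?subr0//.
by rewrite (bilin0l (lie_bilin br)) !add0r subrr.
Qed.

End contractible.

(** * Paths along a fixed vector *)

Section profiles.
Variables (R : realType) (g : vectType R).

Lemma comp_profile (a : R -> R) (x : g) (u : {scalar g}) :
  u \o (fun t => a t *: x) = u x *: a.
Proof. by apply/funext => t /=; rewrite linearZ /=; exact: mulrC. Qed.

Lemma smooth_profile (a : R -> R) (x : g) :
  smooth1 a -> smooth (fun t => a t *: x).
Proof. by move=> sa u; rewrite comp_profile; exact: smooth1Z. Qed.

Lemma vderive_profile (a : R -> R) (x : g) t : smooth1 a ->
  vderive (fun t => a t *: x) t = derive1 a t *: x.
Proof.
move=> sa; apply: vectP => u.
rewrite -[LHS]/((u \o vderive _) t) vderiveE; last exact: smooth_profile.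
by rewrite comp_profile derive1Z// linearZ /=; exact: mulrC.
Qed.

Lemma smooth1_id : smooth1 (@idfun R).
Proof.
apply: (smooth1_ind (P := fun f => f = idfun \/ exists c, f = cst c)); last by left.
move=> _ [->|[c ->]].
- split=> [x|]; first exact: derivable_id.
  by right; exists 1; apply/funext => x; rewrite derive1E derive_id.
- split=> [x|]; first exact: derivable_cst.
  by right; exists 0; apply/funext => x; rewrite derive1E derive_cst.
Qed.

Definition ramp : R -> R := (2 * pi)^-1 *: idfun.

Lemma smooth1_ramp : smooth1 ramp.
Proof. exact/smooth1Z/smooth1_id. Qed.

Lemma ramp0 : ramp 0 = 0.
Proof. exact: mulr0. Qed.

Lemma ramp_end : ramp (2 * pi) = 1.
Proof. by apply: mulVf; rewrite gt_eqF// pi2_gt0. Qed.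

(** The gap between the ramp and its square, which vanishes at both ends: it
    turns a vector into a loop. *)
Definition hump : R -> R := -1 *: (ramp * ramp) + ramp.

Lemma humpE t : hump t = ramp t - ramp t * ramp t.
Proof. by rewrite addrC -mulN1r. Qed.

Lemma smooth1_hump : smooth1 hump.
Proof.
apply: smooth1D smooth1_ramp; apply/smooth1Z/smooth1M; exact: smooth1_ramp.
Qed.

Lemma integral_ramp :
  \int[lebesgue_measure]_(t in `[0, 2 * pi]) (ramp t * derive1 ramp t) = 2^-1.
Proof.
have sr := smooth1_ramp; have sr2 := smooth1M sr sr.
pose F := 2^-1 *: (ramp * ramp).
have dF : derive1 F = (fun t => ramp t * derive1 ramp t).
  rewrite derive1Z// derive1M//; apply/funext => t.
  rewrite -[LHS]/(2^-1 * (derive1 ramp t * ramp t + ramp t * derive1 ramp t)).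
  by field.
rewrite -dF smooth1_FTC; last exact: smooth1Z.
have FE t : F t = 2^-1 * (ramp t * ramp t) by [].
by rewrite !FE ramp0 ramp_end; ring.
Qed.

Lemma integral_hump :
  \int[lebesgue_measure]_(t in `[0, 2 * pi]) (hump t * derive1 ramp t) = 6^-1.
Proof.
have sr := smooth1_ramp; have sr2 := smooth1M sr sr.
have sr3 := smooth1M sr2 sr.
(* F = f^2/2 - f^3/3 is a primitive of (f - f^2) f'. *)
pose F := 2^-1 *: (ramp * ramp) + (- 3^-1) *: (ramp * ramp * ramp).
have dF : derive1 F = (fun t => hump t * derive1 ramp t).
  rewrite derive1D; try exact: smooth1Z.
  rewrite (derive1Z _ sr2) (derive1Z _ sr3) (derive1M sr2 sr) (derive1M sr sr).
  apply/funext => t.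
  rewrite humpE -[LHS]/(
    2^-1 * (derive1 ramp t * ramp t + ramp t * derive1 ramp t) +
    - 3^-1 * ((derive1 ramp t * ramp t + ramp t * derive1 ramp t) * ramp t +
              ramp t * ramp t * derive1 ramp t)).
  by field.
rewrite -dF smooth1_FTC; last by apply: smooth1D; exact: smooth1Z.
have FE t : F t = 2^-1 * (ramp t * ramp t) - 3^-1 * (ramp t * ramp t * ramp t).
  by rewrite -mulNr.
by rewrite !FE ramp0 ramp_end; field.
Qed.

Fact ray_subproof (x : g) :
  (fun t : seg R => ramp (val t) *: x) \in @path_pred R g.
Proof.
apply/asboolP; split; last by rewrite /= ramp0 scale0r.
by exists (fun t => ramp t *: x) => //; exact/smooth_profile/smooth1_ramp.
Qed.

Definition ray (x : g) : path0 g := Path0 (ray_subproof x).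

Fact ray_linear : linear ray.
Proof.
move=> a x y; apply: path_eq => t.
by rewrite /= !fctE scalerDr !scalerA [ramp _ * _]mulrC.
Qed.

HB.instance Definition _ := GRing.isLinear.Build R g (path0 g) _ ray ray_linear.

Lemma ray_end x : ray x (seg1 R) = x.
Proof. by rewrite /= ramp_end scale1r. Qed.

Fact hump_path_subproof (x : g) :
  (fun t : seg R => hump (val t) *: x) \in @path_pred R g.
Proof.
apply/asboolP; split; last by rewrite /= humpE ramp0 mulr0 subr0 scale0r.
by exists (fun t => hump t *: x) => //; exact/smooth_profile/smooth1_hump.
Qed.

Fact hump_loop_subproof (x : g) :
  Path0 (hump_path_subproof x) \in @loop_pred R g.
Proof. by apply/eqP; rewrite /= humpE ramp_end mulr1 subrr scale0r. Qed.

Definition hump_loop (x : g) : loop0 g := Loop0 (hump_loop_subproof x).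

Fact hump_loop_linear : linear hump_loop.
Proof.
move=> a x y; apply: loop_eq => t.
by rewrite /= !fctE scalerDr !scalerA [hump _ * _]mulrC.
Qed.

HB.instance Definition _ :=
  GRing.isLinear.Build R g (loop0 g) _ hump_loop hump_loop_linear.

Definition endpoint (p : path0 g) : g := p (seg1 R).

Fact endpoint_linear : linear endpoint.
Proof. by []. Qed.

HB.instance Definition _ :=
  GRing.isLinear.Build R (path0 g) g _ endpoint endpoint_linear.

Fact detour_subproof (p : path0 g) : p - ray (endpoint p) \in @loop_pred R g.
Proof.
by apply/eqP; rewrite -[LHS]/(p (seg1 R) - ray (p (seg1 R)) (seg1 R)) ray_end subrr.
Qed.

Definition detour (p : path0 g) : loop0 g := Loop0 (detour_subproof p).

Fact detour_linear : linear detour.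
Proof.
move=> a p q; apply: val_inj => /=.
by rewrite (linearP (ray : {linear _ -> _})) scalerBr opprD addrACA.
Qed.

HB.instance Definition _ :=
  GRing.isLinear.Build R (path0 g) (loop0 g) _ detour detour_linear.

Definition loop_path (l : loop0 g) : path0 g := l.

Fact loop_path_linear : linear loop_path.
Proof. by []. Qed.

HB.instance Definition _ :=
  GRing.isLinear.Build R (loop0 g) (path0 g) _ loop_path loop_path_linear.

End profiles.

(** * The cocycle on paths *)

Section sequence.
Variables (R : realType) (g : vectType R) (br : lieBracket g).
Variables (B : invForm br) (k : int).
Let bb := lie_bilin br.
Let fb := form_bilin B.
Let cb := cocycle_bilin B.
Local Notation c := (cocycle B).

Lemma cocyclePl a p q r : c (a *: p + q) r = a * c p r + c q r.
Proof. exact: cb.1. Qed.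

Lemma cocyclePr a p q r : c r (a *: p + q) = a * c r p + c r q.
Proof. exact: cb.2. Qed.

Lemma cocycle_ray (a : R -> R) x y (p : path0 g) : smooth1 a ->
  (forall t, p t = a (val t) *: x) ->
  c p (ray y) =
    B x y * \int[lebesgue_measure]_(t in `[0, 2 * pi]) (a t * derive1 (@ramp R) t).
Proof.
move=> sa pE; have sr := @smooth1_ramp R.
rewrite (cocycleE B (smooth_profile (x := x) sa) (smooth_profile (x := y) sr) pE)//.
rewrite -RintegralZl//; last first.
  by apply: (smooth1_integrable (f := a * _)); exact/smooth1M/smooth1_derive1.
apply: eq_Rintegral => t _.
rewrite vderive_profile// (bilinZl fb) (bilinZr fb) /GRing.scale /=; ring.
Qed.

Lemma cocycle_ray_ray x y : c (ray x) (ray y) = B x y / 2.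
Proof. by rewrite (cocycle_ray y (@smooth1_ramp R) (x := x))// integral_ramp. Qed.

Lemma cocycle_hump_ray x y : c (hump_loop x) (ray y) = B x y / 6.
Proof. by rewrite (cocycle_ray y (@smooth1_hump R) (x := x))// integral_hump. Qed.

(** The cocycle identity expresses each c(p, [q, r]) as the sum of the two other
    c([_, _], _), so that the sum S of the left sides is twice the sum T of
    the c([q, r], p); integration by parts gives S + T = 3 <p, [q, r]> at the
    endpoint, by invariance. *)
Lemma cocycle_br_sum p q r :
  c p (path_br br q r) + c q (path_br br r p) + c r (path_br br p q) =
  2 * B (p (seg1 R)) (br (q (seg1 R)) (r (seg1 R))).
Proof.
have anti x y z : c (path_br br x y) z = - c (path_br br y x) z.
  rewrite -(bilinNl cb); congr (c _ z); exact: (lie_anti (pathLie br)).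
have /= b1 := cocycle_parts B p (path_br br q r).
have /= b2 := cocycle_parts B q (path_br br r p).
have /= b3 := cocycle_parts B r (path_br br p q).
rewrite -(form_cycle B (p _)) in b2.
rewrite (form_cycle B (r _)) in b3.
have := cocycle_br B p q r; have := cocycle_br B q r p; have := cocycle_br B r p q.
rewrite (anti r q) (anti p r) (anti q p).
move: b1 b2 b3.
move: (B _ _) (c _ _) (c _ _) (c _ _) (c _ _) (c _ _) (c _ _) => *; lra.
Qed.

Lemma Pk_br01_central p a : Pk_br01 B k p (0, a) = 0.
Proof.
apply: injective_projections => /=; first by apply: loop_eq => t; exact: (bilin0r bb).
by rewrite (bilin0l cb) mulr0.
Qed.

(** * The inclusion of the based loops *)

Let loopHom0 : {linear loop0 g -> path0 g} := @loop_path R g.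

Definition loopHom1 (l : loop0 g) : Pk_deg1 g := (l, 0).

Fact loopHom1_linear : linear loopHom1.
Proof. by move=> a l m; apply: injective_projections; rewrite /= ?scaler0 ?addr0. Qed.

HB.instance Definition _ :=
  GRing.isLinear.Build R (loop0 g) (Pk_deg1 g) _ loopHom1 loopHom1_linear.

(** A morphism of loops has zero central component, but acting on such a one
    by a loop gives the component 2k c(m, l) = - 2k c(l, m), which has to
    be compensated. *)
Definition loopHom2 (l m : loop0 g) : Pk_deg1 g := (0, 2 * k%:~R * c l m).

Fact loopHom2_bilin : bilin loopHom2.
Proof.
split=> u a x x'; apply: injective_projections; rewrite /= ?scaler0 ?addr0//.
- rewrite -[LHS]/(2 * k%:~R * c (a *: loop_val x + loop_val x') u) cocyclePl.
  by rewrite mulrDr mulrCA.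
- rewrite -[LHS]/(2 * k%:~R * c u (a *: loop_val x + loop_val x')) cocyclePr.
  by rewrite mulrDr mulrCA.
Qed.

Fact loopHom2_anti l m : loopHom2 l m = - loopHom2 m l.
Proof.
apply: injective_projections; rewrite /= ?oppr0//.
by rewrite cocycle_loop mulrN.
Qed.

Fact loopHom_br00 l m :
  Pk_dif0 (loopHom2 l m) = loop_val (loop_br br l m) - path_br br l m.
Proof. by rewrite subrr. Qed.

Fact loopHom_br01 l m :
  loopHom2 l m = loopHom1 (loop_br br l m) - Pk_br01 B k l (loopHom1 m).
Proof.
apply: injective_projections; rewrite /= ?subrr//.
by rewrite cocycle_loop sub0r mulrN.
Qed.

Fact loopHom_jac x y z :
  loopHom1 0 - 0 =
  loopHom2 x (loop_br br y z) + loopHom2 y (loop_br br z x)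
    + loopHom2 z (loop_br br x y)
    + Pk_br01 B k x (loopHom2 y z) + Pk_br01 B k y (loopHom2 z x)
    + Pk_br01 B k z (loopHom2 x y).
Proof.
rewrite !Pk_br01_central !addr0 linear0 subr0.
apply: injective_projections; rewrite /= ?addr0//.
by rewrite -!mulrDr cocycle_br_sum !loop_end (bilin0l fb) !mulr0.
Qed.

Definition loopHom : lie2Hom (EL (loopLie br)) (Pk B k) :=
  @Lie2Hom R (EL (loopLie br)) (Pk B k) loopHom0 loopHom1 loopHom2 (fun=> erefl)
    loopHom2_bilin loopHom2_anti loopHom_br00 loopHom_br01 loopHom_jac.

(** * Evaluation at the endpoint *)

Let evalHom0 : {linear path0 g -> g} := @endpoint R g.
Let evalHom1 : {linear Pk_deg1 g -> R^o} := snd.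

(** On a path and a loop l this has to be 2k c(l, p), the central part of the
    action; integration by parts turns that into an antisymmetric form which
    makes sense for two paths. *)
Definition evalHom2 (p q : path0 g) : R^o := k%:~R * (c q p - c p q).

Fact evalHom2_bilin : bilin evalHom2.
Proof.
split=> u a x x'; rewrite /evalHom2 cocyclePl cocyclePr opprD addrACA -mulrBr.
  by rewrite mulrDr mulrCA.
by rewrite mulrDr mulrCA.
Qed.

Fact evalHom2_anti p q : evalHom2 p q = - evalHom2 q p.
Proof. by rewrite /evalHom2 -mulrN opprB. Qed.

Fact evalHom_chain h : evalHom0 (Pk_dif0 h) = 0.
Proof. exact: loop_end. Qed.

Fact evalHom_br00 p q :
  0 = evalHom0 (path_br br p q) - br (evalHom0 p) (evalHom0 q).
Proof. by rewrite subrr. Qed.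

Fact evalHom_br01 p h : evalHom2 p (Pk_dif0 h) = evalHom1 (Pk_br01 B k p h) - 0.
Proof.
have := cocycle_parts B p h.1; rewrite loop_end (bilin0r fb) => /eqP.
rewrite addr_eq0 subr0 /evalHom2 => /eqP ->.
rewrite opprK /=; ring.
Qed.

(** With S and T the cyclic sums of c(x, [y, z]) and of c([y, z], x), the right
    side is k (T - S), and S = 2 <x, [y, z]>, T = <x, [y, z]> at the
    endpoint. *)
Fact evalHom_jac x y z :
  0 - gk_jac B k (evalHom0 x) (evalHom0 y) (evalHom0 z) =
  evalHom2 x (path_br br y z) + evalHom2 y (path_br br z x)
    + evalHom2 z (path_br br x y)
    + 0 + 0 + 0.
Proof.
rewrite !addr0 sub0r /gk_jac /evalHom2.
have /= b1 := cocycle_parts B x (path_br br y z).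
have /= b2 := cocycle_parts B y (path_br br z x).
have /= b3 := cocycle_parts B z (path_br br x y).
rewrite -(form_cycle B (x _)) in b2; rewrite (form_cycle B (z _)) in b3.
have bs := cocycle_br_sum x y z.
rewrite -!mulrDr -mulrN; congr (_ * _).
move: b1 b2 b3 bs; rewrite /= /endpoint.
move: (B _ _) (c _ _) (c _ _) (c _ _) (c _ _) (c _ _) (c _ _) => *; lra.
Qed.

Definition evalHom : lie2Hom (Pk B k) (gk B k) :=
  @Lie2Hom R (Pk B k) (gk B k) evalHom0 evalHom1 evalHom2 evalHom_chain
    evalHom2_bilin evalHom2_anti evalHom_br00 evalHom_br01 evalHom_jac.

(** * The quasi-inverse of evaluation *)

Let rayHom0 : {linear g -> path0 g} := @ray R g.

Definition rayHom1 (a : R^o) : Pk_deg1 g := (0, a).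

Fact rayHom1_linear : linear rayHom1.
Proof. by move=> a l m; apply: injective_projections; rewrite /= ?scaler0 ?addr0. Qed.

HB.instance Definition _ :=
  GRing.isLinear.Build R R^o (Pk_deg1 g) _ rayHom1 rayHom1_linear.

(** The bracket of two rays has profile f^2 instead of f, and the difference
    f - f^2 is the hump. *)
Definition rayHom2 (x y : g) : Pk_deg1 g := (hump_loop (br x y), 0).

Fact rayHom2_bilin : bilin rayHom2.
Proof.
split=> u a x x'; apply: injective_projections; rewrite /= ?scaler0 ?addr0//.
  by rewrite (bilinDl bb) (bilinZl bb) linearP.
by rewrite (bilinDr bb) (bilinZr bb) linearP.
Qed.

Fact rayHom2_anti x y : rayHom2 x y = - rayHom2 y x.
Proof.
apply: injective_projections; rewrite /= ?oppr0//.
by rewrite (lie_anti br) linearN.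
Qed.

Fact rayHom_chain a : rayHom0 0 = Pk_dif0 (rayHom1 a).
Proof. exact: linear0. Qed.

Fact rayHom_br00 x y :
  Pk_dif0 (rayHom2 x y) = rayHom0 (br x y) - path_br br (rayHom0 x) (rayHom0 y).
Proof.
apply: path_eq => t; rewrite -[RHS]/(ramp (val t) *: br x y -
  br (ramp (val t) *: x) (ramp (val t) *: y)).
by rewrite (bilinZl bb) (bilinZr bb) scalerA -scalerBl -humpE.
Qed.

Fact rayHom_br01 x a : rayHom2 x 0 = rayHom1 0 - Pk_br01 B k (rayHom0 x) (rayHom1 a).
Proof.
rewrite Pk_br01_central subr0; apply: injective_projections => //=.
by rewrite (bilin0r bb) linear0.
Qed.

(** The loop components cancel by the Jacobi identity; each of the three actions
    of a ray on a hump has central component 2k <x, [y, z]> / 6. *)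
Fact rayHom_jac x y z :
  rayHom1 (gk_jac B k x y z) - 0 =
  rayHom2 x (br y z) + rayHom2 y (br z x) + rayHom2 z (br x y)
    + Pk_br01 B k (rayHom0 x) (rayHom2 y z) + Pk_br01 B k (rayHom0 y) (rayHom2 z x)
    + Pk_br01 B k (rayHom0 z) (rayHom2 x y).
Proof.
have jac0 := lie_jacobi br x y z.
rewrite subr0; apply: injective_projections => /=.
- rewrite -!linearD jac0 linear0 add0r; apply: loop_eq => t.
  rewrite -[RHS]/(br (ramp (val t) *: x) (hump (val t) *: br y z) +
    br (ramp (val t) *: y) (hump (val t) *: br z x) +
    br (ramp (val t) *: z) (hump (val t) *: br x y)).
  by rewrite !(bilinZl bb, bilinZr bb) -!scalerDr jac0 !scaler0.
- rewrite !cocycle_hump_ray !addr0 add0r /gk_jac.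
  rewrite ![B (br _ _) _]form_sym -(form_cycle B x) (form_cycle B z).
  by field.
Qed.

Definition rayHom : lie2Hom (gk B k) (Pk B k) :=
  @Lie2Hom R (gk B k) (Pk B k) rayHom0 rayHom1 rayHom2 rayHom_chain
    rayHom2_bilin rayHom2_anti rayHom_br00 rayHom_br01 rayHom_jac.

(** A strict equality: the corrections of the two homomorphisms vanish on the
    pairs concerned, as c(f x, f y) is symmetric in x and y. *)
Lemma eval_ray : iso2Hom (compL2 evalHom rayHom) (idL2 (gk B k)).
Proof.
exists \0; split=> [x|a|x y].
- by rewrite -[RHS]/(x - ray x (seg1 R)) ray_end subrr.
- by rewrite -[RHS]/(a - a) subrr.
- rewrite -[LHS]/(evalHom2 (ray x) (ray y) + 0 - 0) -[RHS]/(0 + 0 - 0 : R).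
  by rewrite /evalHom2 !cocycle_ray_ray (form_sym B y) subrr mulr0.
Qed.

Definition detour_mor (p : path0 g) : Pk_deg1 g := (detour p, 0).

Fact detour_mor_linear : linear detour_mor.
Proof.
by move=> a l m; apply: injective_projections; rewrite /= ?scaler0 ?addr0 ?linearP.
Qed.

HB.instance Definition _ :=
  GRing.isLinear.Build R (path0 g) (Pk_deg1 g) _ detour_mor detour_mor_linear.

(** The loop part of the last condition is an identity between brackets with
    coefficients 1, f and f^2.  In the central part both sides reduce, by parts,
    to k (<p, q> - 2 c(p, q)), with <p, q> taken at the endpoint. *)
Lemma ray_eval : iso2Hom (compL2 rayHom evalHom) (idL2 (Pk B k)).
Proof.
exists detour_mor; split=> [p|[l a]|p q].
- by [].
- apply: injective_projections => /=; last by rewrite subrr.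
  apply: loop_eq => t; rewrite -[LHS]/(l t - ramp (val t) *: l (seg1 R)) loop_end.
  by rewrite scaler0.
- rewrite -[LHS]/(rayHom2 (endpoint p) (endpoint q) + rayHom1 (evalHom2 p q) - 0).
  rewrite -[RHS]/(Pk_br01 B k (ray (endpoint p)) (detour_mor q) +
    - Pk_br01 B k q (detour_mor p) - detour_mor (path_br br p q)).
  apply: injective_projections.
  + apply: loop_eq => t.
    set r := ramp (val t); set p1 := endpoint p; set q1 := endpoint q.
    rewrite -[LHS]/(hump (val t) *: br p1 q1 + 0 - 0) subr0 addr0 humpE -/r.
    rewrite -[RHS]/(br (r *: p1) (q t - r *: q1) - br (q t) (p t - r *: p1) -
      (br (p t) (q t) - r *: br p1 q1)).
    rewrite !(bilinDr bb, bilinNr bb, bilinZl bb, bilinZr bb).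
    rewrite (lie_anti br (q t) (p t)) (lie_anti br (q t) p1).
    rewrite scalerN opprK opprD !opprK opprB scalerBl scalerA.
    clearbody r.
    (* [p(2pi), q(t)] and [p(t), q(t)] occur twice each, with opposite signs. *)
    rewrite [RHS](AC (2*2*2) (((1*4)*(3*6))*(5*2))) /=.
    by rewrite !subrr !add0r.
  + rewrite -[LHS]/(0 + k%:~R * (c q p - c p q) - 0).
    rewrite -[RHS]/(2 * k%:~R * c (q - ray (endpoint q)) (ray (endpoint p)) -
      2 * k%:~R * c (p - ray (endpoint p)) q - 0).
    rewrite !(bilinDl cb) !(bilinNl cb) cocycle_ray_ray.
    have := cocycle_parts B q (ray (endpoint p)); have := cocycle_parts B p q.
    rewrite ray_end -/(endpoint p) -/(endpoint q) (form_sym B (endpoint q)).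
    move: (B _ _) (c _ _) (c _ _) (c _ _) (c _ _) => b c1 c2 c3 c4.
    move=> <- e; have -> : c1 = c4 + c3 - c2 by lra.
    by field.
Qed.

(** * Exactness *)

Lemma exact_loopHom : strictly_exact_at (zeroL2 (trivialL2 R) _) loopHom.
Proof.
have inj (l : loop0 g) : loop_path l = 0 -> l = 0.
  by move=> l0; apply: loop_eq => t; rewrite -[l t]/(loop_path l t) l0.
split; apply/seteqP; split=> y /=.
- by move=> [x _ <-].
- by move=> /inj y0; exists 0 => //; exact/esym.
- move=> [x _ <-]; apply: injective_projections => //=; exact: linear0.
- case: y => l m [/inj l0 m0]; exists 0 => //=.
  by apply/esym; apply: injective_projections.
Qed.

Lemma exact_loopHom_evalHom : strictly_exact_at loopHom evalHom.
Proof.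
split; apply/seteqP; split=> y /=.
- by move=> [l _ <-]; exact: loop_end.
- by move=> /eqP y0; exists (Loop0 (y0 : y \in @loop_pred R g)).
- by move=> [[l m] _ <-]; apply: injective_projections => //=; exact: loop_end.
- case: y => p [l a] [/eqP p0 a0].
  exists (Loop0 (p0 : p \in @loop_pred R g), l) => //.
  by rewrite /hom_mor /= /loopHom1 a0.
Qed.

Lemma exact_evalHom : strictly_exact_at evalHom (zeroL2 _ (trivialL2 R)).
Proof.
split; apply/seteqP; split=> y //= _.
- by exists (ray y) => //; exact: ray_end.
- exists (ray y.1, (0, y.2)) => //.
  by case: y => x a; congr (_, _); exact: ray_end.
Qed.

End sequence.

Theorem theorem5p1 (R : realType) (n : nat) (G : lieGroup R n)
  (g : vectType R) (br : lieBracket g) (B : invForm br) (k : int) :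
  compact [set: G] -> simply_connected R G -> lie_algebra_of G br ->
  simple_lie br -> basic_inner_product B ->
  let pairing := scale_form (4 * pi)^-1 B in
  exists (lambda : lie2Hom (EL (loopLie br)) (Pk pairing k))
         (phi : lie2Hom (Pk pairing k) (gk pairing k)),
    [/\ strictly_exact_at (zeroL2 (trivialL2 R) _) lambda,
        strictly_exact_at lambda phi,
        strictly_exact_at phi (zeroL2 _ (trivialL2 R)),
        lie2_equivalent (EL (loopLie br)) (trivialL2 R)
      & lie2_equivalence phi].
Proof.
move=> _ _ _ _ _ pairing; exists (loopHom pairing k), (evalHom pairing k); split.
- exact: exact_loopHom.
- exact: exact_loopHom_evalHom.
- exact: exact_evalHom.
- exact: EL_trivial.
- by exists (rayHom pairing k); split; [exact: eval_ray|exact: ray_eval].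
Qed.
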